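(* Let $3<p<\infty$ and $\frac1p+\frac1q=1$. Let $\mathcal J:l_p\to l_q$ be the mapping $\mathcal J(x)=(|t_1|^{p-1}\mathrm{sign}(t_1),|t_2|^{p-1}\mathrm{sign}(t_2),\dots)$ for $x=(t_1,t_2,\dots)\in l_p$. Then $\mathcal J$ is Gâteaux differentiable in $l_p$ and, for any $\bar x=(\bar t_1,\bar t_2,\dots)\in l_p$, the Gâteaux derivative $\mathcal J'(\bar x)$ satisfies $$\mathcal J'(\bar x)(v)=\nabla\mathcal J(\bar x)(v)=\{(p-1)|\bar t_n|^{p-2}t_n\}_{n=1}^\infty\in l_q,\quad\text{for any }v=\{t_n\}_{n=1}^\infty\in l_p\setminus\{\theta\}.$$
   Context: $(l_p,\|\cdot\|_p)$ and $(l_q,\|\cdot\|_q)$ are the real sequence spaces, $\theta=(0,0,\dots)$. The Gâteaux derivative is $\mathcal J'(\bar x)(v)=\lim_{t\to0}\frac{\mathcal J(\bar x+tv)-\mathcal J(\bar x)}{t}$ (limit in $l_q$, $t$ real), and $\mathcal J$ is Gâteaux differentiable at $\bar x$ if this limit exists for every $v\in l_p\setminus\{\theta\}$. $\nabla\mathcal J(\bar x)$ is the Fréchet derivative of $\mathcal J$ at $\bar x$. *)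

(* Defs.v *)
From HB Require Import structures.
From mathcomp Require Import all_boot all_order all_algebra.
From mathcomp Require Import all_classical all_reals all_analysis.

Set Implicit Arguments.
Unset Strict Implicit.
Unset Printing Implicit Defensive.

Import Order.TTheory GRing.Theory Num.Theory.
Import numFieldNormedType.Exports.

Local Open Scope classical_set_scope.
Local Open Scope ring_scope.

(* The space l_p: the functions on nat (indices start at 0) whose L^p norm
   with respect to the counting measure is finite.  No quotient is needed, as
   only the empty set is negligible for the counting measure. *)
Definition lp (R : realType) (p : \bar R) (p1 : (1 <= p)%E) : Type :=
  LfunType (@counting nat R) p1.

Lemma counting_eq0 (R : realType) (A : set nat) :
  counting A = 0 :> \bar R -> A = set0.
Proof.
rewrite /counting; case: ifPn => [/asboolP finA|//] [] /eqP.
rewrite pnatr_eq0 finmap.cardfs_eq0 => /eqP A0.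
apply/seteqP; split=> // n An; have := in_fset_set finA n.
by rewrite A0 finmap.in_fset0 mem_set.
Qed.

Section lp_normed.
Context (R : realType) (p : \bar R) (p1 : (1 <= p)%E).

HB.instance Definition _ := GRing.Lmodule.copy (lp p1)
  (LfunType (@counting nat R) p1).

Definition lp_seq (x : lp p1) : nat -> R := x.

Definition lp_norm (x : lp p1) : R :=
  fine ('N[@counting nat R]_p[EFin \o lp_seq x])%E.

Let lp_normD (x y : lp p1) : lp_norm (x + y) <= lp_norm x + lp_norm y.
Proof. exact: (@ler_LnormD _ _ _ (@counting nat R) p p1 x y). Qed.

Let lp_normZ (a : R) (x : lp p1) : lp_norm (a *: x) = `|a| * lp_norm x.
Proof.
apply/eqP; rewrite -eqe; apply/eqP; rewrite EFinM /lp_norm.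
rewrite (@finite_norm_fine _ _ _ (@counting nat R) p p1 x).
rewrite -(@LnormZ _ _ _ (@counting nat R) p p1 x a).
exact: (@finite_norm_fine _ _ _ (@counting nat R) p p1
  (a *: (x : LfunType _ p1))).
Qed.

Let lp_norm0_eq0 (x : lp p1) : lp_norm x = 0 -> x = 0.
Proof.
move=> /(@fine_Lnormr_eq0 _ _ _ (@counting nat R) p p1 x) [A [_ A0 xA]].
apply/(@LfuneqP _ _ _ (@counting nat R) p p1) => n.
have [//|/eqP xn] := eqVneq ((x : LfunType _ p1) n) 0.
have An : A n by apply: xA => /= /(_ I).
by have := counting_eq0 A0; move: An => /[swap] ->.
Qed.

HB.instance Definition _ := @Lmodule_isNormed.Build R (lp p1) lp_norm
  lp_normD lp_normZ lp_norm0_eq0.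

End lp_normed.

Coercion lp_seq : lp >-> Funclass.

Lemma lp_normE (R : realType) (p : R) (p1 : (1 <= p%:E)%E) (x : lp p1) :
  (`|x|%:E = (\sum_(k <oo) (`|x k| `^ p)%:E) `^ p^-1)%E.
Proof.
have p0 : 0 < p by rewrite (lt_le_trans ltr01).
rewrite -[LHS]/((lp_norm x)%:E) /lp_norm.
rewrite (@finite_norm_fine _ _ _ (@counting nat R) p%:E p1 x).
by rewrite (Lnorm_counting _ p0).
Qed.

Lemma lp_memE (R : realType) (p : R) (x : nat -> R) : 0 < p ->
  (x \in Lfun (@counting nat R) p%:E) =
  (\sum_(k <oo) (`|x k| `^ p)%:E < +oo)%E.
Proof.
move=> p0; apply/idP/idP.
  move=> /andP[_ /[!inE]/=]; rewrite /finite_norm (Lnorm_counting _ p0).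
  by apply: lty_poweRy; rewrite invr_eq0 gt_eqF.
move=> xp; rewrite /Lfun /= inE; apply/andP; split; first by rewrite inE.
by rewrite inE /= /finite_norm (Lnorm_counting _ p0); exact: poweR_lty.
Qed.

Section duality_map.
Context (R : realType) (p q : R).
Hypotheses (p_gt3 : 3 < p) (pq : p^-1 + q^-1 = 1).

Lemma exponent_ge1 : (1 <= p%:E)%E.
Proof. by rewrite lee_fin (le_trans _ (ltW p_gt3))// ler1n. Qed.

Lemma conj_exponent_gt1 : 1 < q.
Proof.
have p0 : 0 < p by rewrite (lt_trans _ p_gt3).
have q1 : q^-1 < 1 by rewrite -pq ltrDr invr_gt0.
have q0 : 0 < q^-1.
  have -> : q^-1 = 1 - p^-1 by rewrite -pq addrAC subrr add0r.
  by rewrite subr_gt0 invf_lt1// (lt_trans _ p_gt3)// ltr1n.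
by rewrite -[q]invrK invf_gt1.
Qed.

Lemma conj_exponent_ge1 : (1 <= q%:E)%E.
Proof. by rewrite lee_fin ltW// conj_exponent_gt1. Qed.

Definition duality_seq (x : nat -> R) : nat -> R :=
  fun n => `|x n| `^ (p - 1) * Num.sg (x n).

Lemma duality_seq_mem (x : lp exponent_ge1) :
  duality_seq x \in Lfun (@counting nat R) q%:E.
Proof.
have p0 : 0 < p by rewrite (lt_trans _ p_gt3).
have q0 : 0 < q by rewrite (lt_trans _ conj_exponent_gt1).
have pqE : (p - 1) * q = p.
  have : p * q * (p^-1 + q^-1) = p * q by rewrite pq mulr1.
  rewrite mulrDr [p * q]mulrC mulfK ?gt_eqF// [q * p]mulrC mulfK ?gt_eqF//.
  by rewrite mulrBl mul1r => <-; rewrite addrAC subrr add0r.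
rewrite lp_memE//.
have := LfunP (x : LfunType _ exponent_ge1); rewrite lp_memE//.
congr (_ < _)%E; apply: eq_eseriesr => k _; congr EFin.
rewrite /duality_seq -[X in X `^ _ = _]/(`|x k|) normrM ger0_norm ?powR_ge0// normr_sg.
have [->|xk0] := eqVneq (x k) 0.
  by rewrite normr0 mulr0 !powR0 ?gt_eqF.
by rewrite mulr1 -powRrM pqE.
Qed.

Definition duality_map (x : lp exponent_ge1) : lp conj_exponent_ge1 :=
  Lfun_Sub conj_exponent_ge1 (duality_seq_mem x).

Lemma duality_mapE (x : lp exponent_ge1) n :
  duality_map x n = `|x n| `^ (p - 1) * Num.sg (x n).
Proof. by []. Qed.

End duality_map.

Arguments duality_map {R p q} p_gt3 pq x.

Definition gateaux_differentiable (R : realType) (V W : normedModType R)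
    (f : V -> W) (x : V) : Prop :=
  forall v : V, v != 0 -> derivable f x v.

(* Main.v *)
From HB Require Import structures.
Require Import Defs.
From mathcomp Require Import all_boot all_order all_algebra.
From mathcomp Require Import all_classical all_reals all_analysis.
From mathcomp Require Import ring lra.
Import Order.TTheory GRing.Theory Num.Theory.
Import numFieldNormedType.Exports.
Local Open Scope classical_set_scope.
Local Open Scope ring_scope.

(** J acts coordinatewise by the scalar function phi t = |t|^(p-1) sign t, with
derivative phi' t = (p-1) |t|^(p-2).  Since p > 3, this function has a
quadratic Taylor remainder ([signed_power_remainder]), with r = p - 1 > 2:
  | phi (a + h) - phi a - phi' a * h | <= r^2 M^(r-2) h^2
whenever |a| + |h| <= M.  It follows from the tangent inequality for t^r on
the half line, which is Young's inequality, so that phi never has to be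
differentiated.

The passage to sequences replaces Hoelder's inequality by a homogeneity trick.
Let |h| <= 1 in l_p, write h = |h| k with |k| = 1, and put
y_n = |a_n| + |k_n|.  As |a_n| + |h_n| <= y_n and |h_n| <= |h| y_n, the
remainder at coordinate n is at most r^2 |h|^2 y_n^r, which is r^2 |h|^2 times
the n-th coordinate of J y.  The norm of J y in l_q is |y|^(p-1)
([duality_map_norm]), hence at most (|a| + 1)^(p-1), and therefore
  | J (a + h) - J a - D h | <= r^2 (|a| + 1)^(p-1) |h|^2
([duality_map_remainder]), where D h = ((p-1) |a_n|^(p-2) h_n)_n.  The same
domination by J of a sum of absolute values shows that D maps l_p to l_q and
is bounded.  So D is the Frechet derivative, and the Gateaux derivative is
then equal to it. *)

(** * Taylor estimates for real powers *)

(** Convexity of the power function, in the form of Young's inequality for the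
product of y and x^(r-1) with the conjugate exponents r and r / (r - 1). *)
Lemma powR_tangent {R : realType} (r x y : R) :
  1 < r -> 0 <= x -> 0 <= y ->
  r * x `^ (r - 1) * (y - x) <= y `^ r - x `^ r.
Proof.
move=> r1 x0 y0; have r0 : 0 < r by apply: lt_trans r1.
have s0 : 0 < r - 1 by rewrite subr_gt0.
have := @conjugate_powR R y (x `^ (r - 1)) r (r / (r - 1)) y0 (powR_ge0 _ _) r0.
rewrite -powRrM mulrCA divff ?gt_eqF// mulr1 => /(_ _)/[!divr_gt0]//.
have -> : r^-1 + (r / (r - 1))^-1 = 1 by field; rewrite !gt_eqF.
move=> /(_ isT erefl).
rewrite -(ler_pM2l r0) mulrDr [r * (_ / r)]mulrC divfK ?gt_eqF//.
have -> : r * (x `^ r / (r / (r - 1))) = (r - 1) * x `^ r.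
  by field; rewrite !gt_eqF.
have := @mulr_powRB1 _ x r x0 r0; nra.
Qed.

Lemma powR_lipschitz {R : realType} (r M x y : R) :
  1 < r -> 0 <= x <= M -> 0 <= y <= M ->
  `|y `^ r - x `^ r| <= r * M `^ (r - 1) * `|y - x|.
Proof.
move=> r1; wlog xy : x y / x <= y => [hw xM yM|/andP[x0 xM] /andP[y0 yM]].
  have [xy|yx] := leP x y; first exact: hw.
  by rewrite distrC [`|y - x|]distrC hw// ltW.
have r0 : 0 < r by apply: lt_trans r1.
rewrite !ger0_norm ?subr_ge0 ?ge0_ler_powR ?nnegrE ?(ltW r0)//.
have := @powR_tangent _ r y x r1 y0 x0.
rewrite -lerN2 opprB -mulrN opprB => /le_trans; apply.
rewrite ler_wpM2r ?subr_ge0// ler_wpM2l ?(ltW r0)//.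
by rewrite ge0_ler_powR ?nnegrE ?subr_ge0 ?(ltW r1)// (le_trans y0).
Qed.

(** The tangent inequality at x makes the remainder nonnegative; the one at y
bounds it by r (y^(r-1) - x^(r-1)) (y - x), where y^(r-1) - x^(r-1) is
estimated by the Lipschitz bound. *)
Lemma powR_remainder {R : realType} (r M x y : R) :
  2 < r -> 0 <= x <= M -> 0 <= y <= M ->
  `|y `^ r - x `^ r - r * x `^ (r - 1) * (y - x)|
    <= r ^+ 2 * M `^ (r - 2) * (y - x) ^+ 2.
Proof.
move=> r2 /andP[x0 xM] /andP[y0 yM].
have r1 : 1 < r by apply: lt_trans r2; rewrite ltr1n.
have r0 : 0 < r by apply: lt_trans r1.
have s1 : 1 < r - 1 by rewrite ltrBrDr.
have lo := @powR_tangent _ r x y r1 x0 y0.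
have up := @powR_tangent _ r y x r1 y0 x0.
have := @powR_lipschitz _ (r - 1) M x y s1.
rewrite x0 xM y0 yM -addrA -opprD => /(_ isT isT) lip.
rewrite ger0_norm ?subr_ge0//.
apply: (@le_trans _ _ (r * `|y `^ (r - 1) - x `^ (r - 1)| * `|y - x|)).
  rewrite -[leRHS]mulrA -normrM.
  have := ler_norm ((y `^ (r - 1) - x `^ (r - 1)) * (y - x)).
  move=> /(ler_wpM2l (ltW r0)); apply: le_trans; nra.
have M0 := powR_ge0 M (r - 2).
rewrite -[(y - x) ^+ 2]real_normK ?num_real//.
have d0 := normr_ge0 (y - x).
apply: (@le_trans _ _ (r * ((r - 1) * M `^ (r - 2) * `|y - x| * `|y - x|))).
  by rewrite -mulrA ler_wpM2l ?(ltW r0)// ler_wpM2r.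
have := mulr_ge0 M0 (mulr_ge0 d0 d0); nra.
Qed.

Definition signed_power {R : realType} (r t : R) := `|t| `^ r * Num.sg t.

Lemma signed_powerN {R : realType} (r t : R) :
  signed_power r (- t) = - signed_power r t.
Proof. by rewrite /signed_power normrN sgrN mulrN. Qed.

Lemma ge0_signed_power {R : realType} (r t : R) : r != 0 -> 0 <= t ->
  signed_power r t = t `^ r.
Proof.
move=> r0; rewrite /signed_power le_eqVlt => /predU1P[<-|t0].
  by rewrite sgr0 mulr0 powR0.
by rewrite gtr0_sg// mulr1 gtr0_norm.
Qed.

(** By oddness a may be taken nonnegative.  If a + h is nonnegative as well,
this is the remainder of the power function.  Otherwise a and |a + h| add up to
|h|, so each of the three terms is at most |h|^r up to a factor 1 or r, and
|h|^r <= M^(r-2) h^2.  The constant r^2 covers all cases: as r > 2, it exceeds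
r (r - 1), r and 2. *)
Lemma signed_power_remainder {R : realType} (r M a h : R) :
  2 < r -> `|a| + `|h| <= M ->
  `|signed_power r (a + h) - signed_power r a - r * `|a| `^ (r - 1) * h|
    <= r ^+ 2 * M `^ (r - 2) * h ^+ 2.
Proof.
move=> r2; wlog a0 : a h / 0 <= a => [hw ahM|].
  have [a0|/ltW a0] := leP 0 a; first exact: hw.
  have := hw (- a) (- h); rewrite !normrN oppr_ge0 => /(_ a0 ahM).
  rewrite -opprD !signed_powerN sqrrN mulrN -!opprD normrN; exact.
rewrite (ger0_norm a0) => ahM.
have r0 : 0 < r by apply: lt_trans r2.
have h0 := normr_ge0 h; have aM : a <= M by lra.
rewrite (@ge0_signed_power _ r a) ?gt_eqF//.
have [b0|b0] := leP 0 (a + h).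
  rewrite ge0_signed_power ?gt_eqF//.
  have := @powR_remainder _ r M a (a + h) r2.
  rewrite [a + h - a]addrAC subrr add0r; apply; first exact/andP.
  by rewrite b0 (le_trans _ ahM)// lerD2l ler_norm.
have hE : `|h| = - h by rewrite ltr0_norm//; lra.
rewrite -[a + h]opprK signed_powerN.
rewrite ge0_signed_power ?gt_eqF ?oppr_ge0 ?(ltW b0)//.
have hM : `|h| `^ r <= M `^ (r - 2) * h ^+ 2.
  have -> : `|h| `^ r = `|h| `^ (r - 2) * `|h| ^+ 2.
    rewrite -[`|h| ^+ 2]powR_mulrn// -powRD ?subrK//.
    by rewrite gt_eqF.
  rewrite real_normK ?num_real// ler_wpM2r ?sqr_ge0//.
  by rewrite ge0_ler_powR ?nnegrE//; lra.
have bh : (- (a + h)) `^ r <= `|h| `^ r by rewrite ge0_ler_powR ?nnegrE//; lra.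
have ah : a `^ r <= `|h| `^ r by rewrite ge0_ler_powR ?nnegrE//; lra.
have ah1 : a `^ (r - 1) * `|h| <= `|h| `^ r.
  rewrite -[leRHS](@mulr_powRB1 _ `|h| r)// mulrC ler_wpM2l//.
  by rewrite ge0_ler_powR ?nnegrE//; lra.
have a1 := powR_ge0 a r; have a2 := powR_ge0 (- (a + h)) r.
have a3 := mulr_ge0 (powR_ge0 a (r - 1)) h0.
have H0 := powR_ge0 `|h| r.
apply: (@le_trans _ _ (r ^+ 2 * `|h| `^ r)); last first.
  by rewrite -mulrA ler_wpM2l// sqr_ge0.
have E : r * a `^ (r - 1) * h = - (r * (a `^ (r - 1) * `|h|)).
  by rewrite hE; ring.
have rP0 : 0 <= r * (a `^ (r - 1) * `|h|) by rewrite mulr_ge0// ltW.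
have rP : r * (a `^ (r - 1) * `|h|) <= r * `|h| `^ r by rewrite ler_wpM2l// ltW.
have rN : r * `|h| `^ r <= r ^+ 2 * `|h| `^ r by rewrite ler_wpM2r//; nra.
have N2 : 2 * `|h| `^ r <= r ^+ 2 * `|h| `^ r by rewrite ler_wpM2r//; nra.
rewrite E ler_norml; apply/andP; split; lra.
Qed.

(** * Domination in sequence spaces *)

Section Lp.
Context {R : realType} {p : R} {p1 : (1 <= p%:E)%E}.
Implicit Types x y : lp p1.

Let p0 : 0 < p.
Proof. by rewrite (lt_le_trans ltr01). Qed.

Lemma lp_seqD x y n : lp_seq (x + y) n = x n + y n.
Proof. by []. Qed.

Lemma lp_seqB x y n : lp_seq (x - y) n = x n - y n.
Proof. by []. Qed.

Lemma lp_seqZ (c : R) x n : lp_seq (c *: x) n = c * x n.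
Proof. by []. Qed.

Lemma lp_eqP x y : lp_seq x =1 lp_seq y -> x = y.
Proof. by move/(@LfuneqP _ _ _ (@counting nat R) p%:E p1). Qed.

Lemma lp_domination (u : nat -> R) y : (forall n, `|u n| <= `|y n|) ->
  u \in Lfun (@counting nat R) p%:E.
Proof.
move=> uy; rewrite lp_memE//.
have := LfunP (y : LfunType _ p1); rewrite lp_memE//; apply: le_lt_trans.
apply: lee_nneseries => n _; first by rewrite lee_fin powR_ge0.
by rewrite lee_fin ge0_ler_powR ?nnegrE ?(ltW p0)//; exact: uy.
Qed.

Lemma lp_norm_powR x : ((`|x| `^ p)%:E = \sum_(k <oo) (`|x k| `^ p)%:E)%E.
Proof.
by rewrite -poweR_EFin lp_normE -poweRrM mulVf ?gt_eqF// poweRe1// nneseries_ge0.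
Qed.

Lemma lp_norm_mono x y : (forall n, `|x n| <= `|y n|) -> `|x| <= `|y|.
Proof.
move=> xy; rewrite leNgt; apply/negP => /(gt0_ltr_powR p0).
rewrite !nnegrE !normr_ge0 => /(_ isT isT); apply/negP; rewrite -leNgt.
rewrite -lee_fin !lp_norm_powR; apply: lee_nneseries => n _.
  by rewrite lee_fin powR_ge0.
by rewrite lee_fin ge0_ler_powR ?nnegrE ?(ltW p0)//; exact: xy.
Qed.

Lemma lp_norm_le (c : R) x y : 0 <= c ->
  (forall n, `|x n| <= c * `|y n|) -> `|x| <= c * `|y|.
Proof.
move=> c0 xy; rewrite -[X in X * _](ger0_norm c0) -normrZ.
apply: lp_norm_mono => n; rewrite lp_seqZ normrM ger0_norm//; exact: xy.
Qed.

Lemma lp_abs_le x n : `| `|x n| | <= `|x n|.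
Proof. by rewrite normr_id. Qed.

Definition lp_abs x : lp p1 :=
  Lfun_Sub p1 (@lp_domination (fun n => `|x n|) x (lp_abs_le x)).

Lemma lp_abs_norm x : `|lp_abs x| = `|x|.
Proof.
apply/eqP; rewrite eq_le !lp_norm_mono// => n;
  by rewrite [lp_abs x n]/= normr_id.
Qed.

Lemma lp_abs_sum_norm x y : `|lp_abs x + lp_abs y| <= `|x| + `|y|.
Proof. by rewrite -(lp_abs_norm x) -(lp_abs_norm y) ler_normD. Qed.

End Lp.

(** * The derivative of the duality map *)

Section Duality.
Context {R : realType} {p q : R} (p_gt3 : 3 < p) (pq : p^-1 + q^-1 = 1).

Notation J := (duality_map p_gt3 pq).
Implicit Types a h v : lp (exponent_ge1 p_gt3).

Let p0 : 0 < p. Proof. by apply: lt_trans p_gt3. Qed.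
Let r2 : 2 < p - 1. Proof. by move: p_gt3; lra. Qed.
Let r0 : 0 < p - 1. Proof. exact: lt_trans r2. Qed.

Lemma duality_map_signed_power a n : J a n = signed_power (p - 1) (a n).
Proof. by []. Qed.

(** The exponents satisfy (p - 1) q = p, so the q-th powers of the coordinates
of J a are the p-th powers of those of a. *)
Lemma duality_map_norm a : `|J a| = `|a| `^ (p - 1).
Proof.
have q0 : 0 < q by apply: lt_trans (conj_exponent_gt1 p_gt3 pq).
have pqE : p - 1 = p * q^-1.
  have -> : q^-1 = 1 - p^-1 by rewrite -pq addrAC subrr add0r.
  by rewrite mulrBr mulr1 divff ?gt_eqF.
have E : `|J a| `^ q = `|a| `^ p.
  apply: EFin_inj; rewrite !lp_norm_powR; apply: eq_eseriesr => n _.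
  congr EFin; rewrite duality_mapE normrM normr_sg ger0_norm ?powR_ge0//.
  have [->|an0] := eqVneq (a n) 0.
    by rewrite normr0 mulr0 !powR0 ?gt_eqF.
  by rewrite mulr1 -powRrM pqE divfK ?gt_eqF.
by rewrite pqE powRrM -E -powRrM divff ?gt_eqF// powRr1.
Qed.

(** Every l_q estimate below compares a sequence with a multiple of this one:
being a value of J, it has a norm controlled by |a| + |h| alone. *)
Definition majorant a h : lp (conj_exponent_ge1 p_gt3 pq) :=
  J (lp_abs a + lp_abs h).

Lemma majorantE a h n : `|majorant a h n| = (`|a n| + `|h n|) `^ (p - 1).
Proof.
rewrite duality_map_signed_power ge0_signed_power ?gt_eqF//.
  by rewrite ger0_norm ?powR_ge0.
by rewrite lp_seqD addr_ge0 ?normr_ge0.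
Qed.

Lemma majorant_norm a h : `|majorant a h| <= (`|a| + `|h|) `^ (p - 1).
Proof.
rewrite duality_map_norm ge0_ler_powR ?nnegrE ?(ltW r0) ?addr_ge0//.
exact: lp_abs_sum_norm.
Qed.

Definition duality_deriv_seq a h n : R := (p - 1) * `|a n| `^ (p - 2) * h n.

Lemma duality_deriv_le a h n :
  `|duality_deriv_seq a h n| <= (p - 1) * `|majorant a h n|.
Proof.
rewrite majorantE !normrM (ger0_norm (ltW r0)) -mulrA ler_wpM2l ?(ltW r0)//.
rewrite (ger0_norm (powR_ge0 _ _)).
rewrite -[leRHS](@mulr_powRB1 _ (`|a n| + `|h n|)) ?addr_ge0//.
have -> : p - 1 - 1 = p - 2 by ring.
have s0 : 0 <= p - 2 by move: r2; lra.
rewrite [leLHS]mulrC ler_pM ?powR_ge0 ?lerDr//.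
by rewrite ge0_ler_powR ?nnegrE ?lerDl// addr_ge0.
Qed.

Lemma duality_deriv_mem a h :
  duality_deriv_seq a h \in Lfun (@counting nat R) q%:E.
Proof.
apply: (@lp_domination _ _ (conj_exponent_ge1 p_gt3 pq) _
  ((p - 1) *: majorant a h)) => n.
by rewrite lp_seqZ [leRHS]normrM (ger0_norm (ltW r0)) duality_deriv_le.
Qed.

Definition duality_deriv a h : lp (conj_exponent_ge1 p_gt3 pq) :=
  Lfun_Sub (conj_exponent_ge1 p_gt3 pq) (duality_deriv_mem a h).

Lemma duality_derivE a h n :
  duality_deriv a h n = (p - 1) * `|a n| `^ (p - 2) * h n.
Proof. by []. Qed.

Lemma duality_deriv_is_linear a : linear (duality_deriv a).
Proof.
move=> c u v; apply: lp_eqP => n.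
by rewrite lp_seqD lp_seqZ !duality_derivE lp_seqD lp_seqZ; ring.
Qed.

HB.instance Definition _ a := GRing.isLinear.Build R
  (lp (exponent_ge1 p_gt3)) (lp (conj_exponent_ge1 p_gt3 pq)) _
  (duality_deriv a) (duality_deriv_is_linear a).

Lemma duality_deriv_norm a h :
  `|duality_deriv a h| <= (p - 1) * (`|a| + `|h|) `^ (p - 1).
Proof.
apply: (@le_trans _ _ ((p - 1) * `|majorant a h|)).
  by apply: lp_norm_le => [|n]; [exact: ltW|exact: duality_deriv_le].
by rewrite ler_wpM2l ?(ltW r0) ?majorant_norm.
Qed.

Lemma duality_deriv_continuous a : continuous (duality_deriv a).
Proof.
apply/linear_bounded_continuous/bounded_funP => r.
exists ((p - 1) * (`|a| + r) `^ (p - 1)) => h hr.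
apply: le_trans (duality_deriv_norm a h) _.
rewrite ler_wpM2l ?(ltW r0)// ge0_ler_powR ?nnegrE ?(ltW r0) ?addr_ge0 ?lerD2l//.
exact: le_trans hr.
Qed.

(** The majorant is taken at a and the unit vector k = h / |h|; this
moves the factor |h|^2 out of the majorant, whose norm stays bounded. *)
Lemma duality_map_remainder a h : `|h| <= 1 ->
  `|J (a + h) - J a - duality_deriv a h|
    <= (p - 1) ^+ 2 * (`|a| + 1) `^ (p - 1) * `|h| ^+ 2.
Proof.
have [->|h0] := eqVneq h 0.
  by move=> _; rewrite addr0 subrr linear0 subr0 !normr0 expr0n mulr0.
have H0 : 0 < `|h| by rewrite normr_gt0.
move=> h1; pose k : lp (exponent_ge1 p_gt3) := `|h|^-1 *: h.
have kn n : `|h n| = `|h| * `|k n|.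
  by rewrite /k lp_seqZ normrM normfV normr_id mulrA divff ?mul1r ?gt_eqF.
have k1 : `|k| = 1 by rewrite normrZ normfV normr_id mulVf ?gt_eqF.
rewrite mulrAC.
apply: (@le_trans _ _ ((p - 1) ^+ 2 * `|h| ^+ 2 * `|majorant a k|)); last first.
  have := majorant_norm a k; rewrite k1 => Jak.
  by rewrite ler_wpM2l// mulr_ge0// sqr_ge0.
apply: lp_norm_le => [|n]; first by rewrite mulr_ge0// sqr_ge0.
rewrite majorantE !lp_seqB !duality_map_signed_power duality_derivE lp_seqD.
have -> : p - 2 = p - 1 - 1 by ring.
have ahM : `|a n| + `|h n| <= `|a n| + `|k n|.
  by rewrite lerD2l kn ler_piMl.
apply: le_trans (signed_power_remainder _ _ _ _ r2 ahM) _.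
rewrite -[leLHS]mulrA -[leRHS]mulrA ler_wpM2l ?sqr_ge0//.
rewrite -[h n ^+ 2]real_normK ?num_real// kn exprMn mulrCA ler_wpM2l ?sqr_ge0//.
have M0 : 0 <= `|a n| + `|k n| by rewrite addr_ge0.
(* Two of the p - 1 factors absorb k_n^2. *)
have -> : (`|a n| + `|k n|) `^ (p - 1) =
    (`|a n| + `|k n|) `^ (p - 1 - 2) * (`|a n| + `|k n|) ^+ 2.
  rewrite -[_ ^+ 2]powR_mulrn// -powRD ?subrK//.
  by rewrite gt_eqF.
by rewrite ler_wpM2l ?powR_ge0// ler_pXn2r ?nnegrE// lerDr.
Qed.

Lemma duality_map_expansion a :
  J \o shift a = cst (J a) + duality_deriv a +o_ (0 : lp (exponent_ge1 p_gt3)) id.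
Proof.
apply/eqaddoP => e e0 /=.
set C := (p - 1) ^+ 2 * (`|a| + 1) `^ (p - 1).
have C0 : 0 < C by rewrite mulr_gt0 ?exprn_gt0// powR_gt0// ltr_wpDl.
(* Radius 1 lets the quadratic bound apply; e / C makes C |h|^2 <= e |h|. *)
apply/nbhs_norm0P; exists (Num.min 1 (e / C)).
  by rewrite /= lt_min ltr01 divr_gt0.
move=> h /=; rewrite lt_min => /andP[/ltW h1 heC].
rewrite -[X in `|X|]/(J (h + a) - (J a + duality_deriv a h)) opprD addrA.
rewrite [h + a]addrC.
apply: le_trans (duality_map_remainder a h h1) _; rewrite -/C.
by rewrite expr2 mulrA ler_wpM2r// mulrC -ler_pdivlMr// ltW.
Qed.

Lemma duality_map_diff a : differentiable J a /\
  'd J a = duality_deriv a :> (_ -> _).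
Proof.
have E := diff_unique (@duality_deriv_continuous a) (duality_map_expansion a).
split=> //; apply/diff_locallyP; rewrite E.
by split; [exact: duality_deriv_continuous|exact: duality_map_expansion].
Qed.

End Duality.

Theorem corollary6p2 (R : realType) (p q : R)
    (p_gt3 : 3 < p) (pq : p^-1 + q^-1 = 1) :
  let J : lp (exponent_ge1 p_gt3) -> lp (conj_exponent_ge1 p_gt3 pq) :=
    duality_map p_gt3 pq in
  forall xbar : lp (exponent_ge1 p_gt3),
    [/\ gateaux_differentiable J xbar,
        differentiable J xbar &
        forall v : lp (exponent_ge1 p_gt3), v != 0 ->
          'D_v J xbar = 'd J xbar v /\
          lp_seq ('d J xbar v) =
            (fun n : nat => (p - 1) * `|xbar n| `^ (p - 2) * v n)].
Proof.
move=> J xbar; have [dJ dE] := duality_map_diff p_gt3 pq xbar; split => //.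
  by move=> v _; exact: diff_derivable.
by move=> v _; split; [rewrite deriveE|rewrite dE].
Qed.
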